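(* Let $n\ge 2$ and let $G=\langle a,b\rangle$ be an infinite periodic GGS-group acting on the $2^n$-adic tree. Let $m_G\in\mathbb{N}$ be the number associated to $G$ defined in the context. Then for every integer $k\ge m_G$ the quotient $G/\mathrm{St}_G(k)$ does not admit a mixed Beauville structure.
   Context: Throughout $p=2$. **Trees and GGS-groups.** Let $T$ be the rooted $p^n$-adic tree, with vertices the words over $A=\{1,\dots,p^n\}$; automorphisms act on the right. $\mathrm{St}_{\mathrm{Aut}(T)}(k)$ is the pointwise stabiliser of all vertices of level $k$, and $\mathrm{St}_G(k)=G\cap \mathrm{St}_{\mathrm{Aut}(T)}(k)$ for $G\le\mathrm{Aut}(T)$. For $f\in\mathrm{Aut}(T)$ and a vertex $u$, the section $f_u\in\mathrm{Aut}(T)$ is defined by $(uv)^f=u^f v^{f_u}$ for all words $v$. The isomorphism $\psi:\mathrm{St}_{\mathrm{Aut}(T)}(1)\to \mathrm{Aut}(T)\times\overset{p^n}{\cdots}\times\mathrm{Aut}(T)$ sends $g$ to the tuple of its first-level sections. Given a non-zero vector $\mathbf{e}=(e_1,\dots,e_{p^n-1})\in(\mathbb{Z}/p^n\mathbb{Z})^{p^n-1}$, the GGS-group with defining vector $\mathbf e$ is $G=\langle a,b\rangle\le\mathrm{Aut}(T)$, where $a$ is the rooted automorphism permuting the first-level subtrees rigidly according to the cycle $(1\,2\,\cdots\,p^n)$, and $b\in \mathrm{St}_{\mathrm{Aut}(T)}(1)$ is defined recursively by $\psi(b)=(a^{e_1},\dots,a^{e_{p^n-1}},b)$. The group is periodic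 if all its elements have finite order. **Commutators.** $x^y=y^{-1}xy$, $[x,y]=x^{-1}y^{-1}xy$, $[x,y,z]=[[x,y],z]$. **The numbers $R_j$.** $R_0$ is the largest integer ($\le n$) such that $p^{R_0}\mid e_\ell$ for all $\ell\in\{1,\dots,p^n-1\}$; for $j\ge 0$, while $R_j<n$, $R_{j+1}$ is the largest integer ($\le n$) such that $p^{R_{j+1}}\mid e_\ell$ for all $\ell\in\{p^{R_j},2p^{R_j},\dots,p^n-p^{R_j}\}$. For $G$ infinite there is some $1\le q\le n-1$ with $R_q=R_{q+1}<n$; fix such a $q$ (the value $R_q$ does not depend on the choice). **The numbers $S[k]$.** For $k\in\{0,\dots,n-1\}$, $S[k]=e_{p^k}+e_{2p^k}+\cdots+e_{p^n-p^k}$. (A GGS-group is periodic if and only if $S[k]\equiv 0 \pmod{p^{k+1}}$ for all $k\in\{0,\dots,n-1\}$.) **The numbers $m_{r,s}$.** Let $G$ be periodic, $0\le r<n$, $0\le s<n-R_0$. If $p^{n-s}\mid S[r]$, set $m_{r,s}=0$. If $p^{n-s}\nmid S[r]$, then $m_{r,s}$ is the number with $1\le m_{r,s}<n$ for which there are $t_0,\dots,t_{m_{r,s}}\in\mathbb{N}$ such that: $t_k<n-s\le t_{m_{r,s}}$ for all $k<m_{r,s}$; $p^{t_0}\mid S[r]$ and $p^{t_0+1}\nmid S[r]$; $p^{t_k}\mid S[t_{k-1}+s]$ and $p^{t_k+1}\nmid S[t_{k-1}+s]$ for $1\le k<m_{r,s}$; and $p^{t_{m_{r,s}}}\mid S[t_{m_{r,s}-1}+s]$.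 **The number $m_G$.** Let $G$ be infinite and periodic, let $p^d$ be the order of $[a^{p^{R_q}},b,a^{p^{R_q}}]b$ in $G$, and let $\lambda'$ be the minimal level of the tree at which all sections of $\big([a^{p^{R_q}},b,a^{p^{R_q}}]b\big)^{p^{d-1}}$ that involve $b$ (that is, that are not powers of $a$) are of the form $(b^{x})^{a^{y}}$ for some integers $x,y$. Put $m=\max\{m_{0,0}+\lambda',\,m_{1,0}\}$ and $m_G=m+3$. **Mixed Beauville structures.** For a finite group $H$, a subgroup $M\le H$ and $x,y\in M$ with $M=\langle x,y\rangle$, let $\Sigma(x,y)=\bigcup_{g\in M}\big(\langle x\rangle^g\cup\langle y\rangle^g\cup\langle xy\rangle^g\big)$. A mixed Beauville structure for $H$ is a triple $(H,M,X)$ with $M\le H$ a subgroup of index $2$ and $X=\{x,y\}$ such that: $M=\langle x,y\rangle$; there exists $h_0\in H\setminus M$ with $h_0^{-1}\Sigma(x,y)h_0\cap\Sigma(x,y)=\{1\}$; and for all $h\in H\setminus M$ we have $h^2\notin\Sigma(x,y)$. *)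

(* Defs.v *)
From HB Require Import structures.
From mathcomp Require Import all_boot all_order all_fingroup all_algebra.
From mathcomp Require Import boolp classical_sets cardinality.

Set Implicit Arguments.
Unset Strict Implicit.
Unset Printing Implicit Defensive.

Local Open Scope group_scope.

Section Groups.
Variable gT : groupType.
Implicit Types (X H : set gT) (x y : gT).

Definition is_subgroup H : Prop :=
  H 1 /\ forall x y, H x -> H y -> H (x * y^-1).

Definition generated X : set gT := smallest is_subgroup X.

Lemma generated_subgroup X : is_subgroup (generated X).
Proof.
split=> [H [[H1 _] _] //|x y Hx Hy H [HH XH]].
by apply: HH.2; [apply: Hx|apply: Hy].
Qed.

Definition periodic H : Prop :=
  forall x, H x -> exists2 m, (0 < m)%N & x ^+ m = 1.

Definition has_order x (m : nat) : Prop :=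
  [/\ (0 < m)%N, x ^+ m = 1 & forall j, (0 < j < m)%N -> x ^+ j <> 1].

Definition expgz x (z : int) : gT :=
  match z with Posz m => x ^+ m | Negz m => x ^- m.+1 end.

End Groups.

(* The vertices are the words over 'I_d, so the letter i of {1, ..., d} is the
   ordinal of value i - 1; u is an ancestor of v when u is a prefix of v. *)

Record aut (d : nat) := Aut {
  act :> seq 'I_d -> seq 'I_d;
  act_inv : seq 'I_d -> seq 'I_d;
  actK : cancel act act_inv;
  act_invK : cancel act_inv act;
  size_act : forall w, size (act w) = size w;
  prefix_act : {mono act : u v / prefix u v} }.

Section AutGroup.
Variable d : nat.
Implicit Types (f g h : aut d) (u v w : seq 'I_d).

Lemma autP f g : f =1 g -> f = g.
Proof.
case: f => f f' fK f'K fs fp; case: g => g g' gK g'K gs gp /= /funext E.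
subst g.
have E' : f' = g' by apply: funext => w; rewrite -{1}(g'K w) fK.
subst g'.
by rewrite (Prop_irrelevance fK gK) (Prop_irrelevance f'K g'K)
           (Prop_irrelevance fs gs) (Prop_irrelevance fp gp).
Qed.

Definition aut1 : aut d := @Aut d id id
  (fun=> erefl) (fun=> erefl) (fun=> erefl) (fun _ _ => erefl).

Definition aut_inv f : aut d.
Proof.
refine (@Aut d (act_inv f) f (@act_invK d f) (@actK d f) _ _).
- by move=> w; rewrite -(size_act f) act_invK.
- by move=> u v; rewrite -(prefix_act f) !act_invK.
Defined.

(* Right action: first f, then g. *)
Definition aut_mul f g : aut d.
Proof.
refine (@Aut d (g \o f) (act_inv f \o act_inv g)
  (can_comp (@actK d g) (@actK d f)) (can_comp (@act_invK d f) (@act_invK d g))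
  _ _).
- by move=> w /=; rewrite !size_act.
- by move=> u v /=; rewrite !prefix_act.
Defined.

HB.instance Definition _ := gen_eqMixin (aut d).
HB.instance Definition _ := gen_choiceMixin (aut d).

Lemma aut_mulA : associative aut_mul. Proof. by move=> f g h; apply: autP. Qed.
Lemma aut_mul1g : left_id aut1 aut_mul. Proof. by move=> f; apply: autP. Qed.
Lemma aut_mulg1 : right_id aut1 aut_mul. Proof. by move=> f; apply: autP. Qed.
Lemma aut_mulVg : left_inverse aut1 aut_inv aut_mul.
Proof. by move=> f; apply: autP => w /=; rewrite act_invK. Qed.
Lemma aut_mulgV : right_inverse aut1 aut_inv aut_mul.
Proof. by move=> f; apply: autP => w /=; rewrite actK. Qed.

HB.instance Definition _ := isGroup.Build (aut d)
  aut_mulA aut_mul1g aut_mulg1 aut_mulVg aut_mulgV.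

Lemma act1 w : (1 : aut d) w = w. Proof. by []. Qed.
Lemma actM f g w : (f * g) w = g (f w). Proof. by []. Qed.
Lemma actVK f w : f^-1 (f w) = w. Proof. exact: actK. Qed.
Lemma actKV f w : f (f^-1 w) = w. Proof. exact: act_invK. Qed.

Lemma act_cat f u v : f (u ++ v) = f u ++ drop (size u) (f (u ++ v)).
Proof.
have /prefixP[s ->] : prefix (f u) (f (u ++ v)).
  by rewrite prefix_act prefix_prefix.
by rewrite -(size_act f u) drop_size_cat.
Qed.

Lemma prefix_cat2l u v w : prefix (u ++ v) (u ++ w) = prefix v w.
Proof. by elim: u => //= x u ->; rewrite eqxx. Qed.

Let sec f u v := drop (size u) (f (u ++ v)).
Let sec_inv f u v := drop (size u) (f^-1 (f u ++ v)).
Let sec_cat f u v : f (u ++ v) = f u ++ sec f u v.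
Proof. exact: act_cat. Qed.
Let sec_invP f u v : f^-1 (f u ++ v) = u ++ sec_inv f u v.
Proof. by have := act_cat f^-1 (f u) v; rewrite actVK size_act. Qed.

(* The section f_u, determined by (uv)^f = u^f v^(f_u). *)
Definition section f u : aut d.
Proof.
refine (@Aut d (sec f u) (sec_inv f u) _ _ _ _) => [v|v|v|v w].
- by rewrite /sec_inv -sec_cat actVK drop_size_cat.
- by rewrite /sec -sec_invP actKV -(size_act f u) drop_size_cat.
- by rewrite /sec size_drop size_act size_cat addKn.
- by rewrite -(prefix_cat2l (f u)) -!sec_cat prefix_act prefix_cat2l.
Defined.

Lemma sectionE f u v : f (u ++ v) = f u ++ section f u v.
Proof. exact: sec_cat. Qed.

Definition stabilizer (k : nat) : set (aut d) :=
  [set f | forall w, size w = k -> f w = w]%classic.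

End AutGroup.

Record autgroup (d : nat) := AutGroup {
  autset :> set (aut d);
  autgroupP : is_subgroup autset }.

Section CongruenceQuotient.
Variables (d : nat) (G : autgroup d) (k : nat).

Definition St : set (aut d) := (G `&` stabilizer k)%classic.

Definition St_coset (g : aut d) : set (aut d) := [set g * s | s in St]%classic.

(* The elements of G/St_G(k) are the cosets of St_G(k) in G, with the product
   and the inverse of sets; the instances below make it a finite group. *)
Record congr_quot := CongrQuot {
  quot_set :> set (aut d);
  quot_setP : exists2 g, autset G g & quot_set = St_coset g }.

Let G1 : autset G 1. Proof. exact: (autgroupP G).1. Qed.
Let GV x : autset G x -> autset G x^-1.
Proof. by move=> Gx; rewrite -[x^-1]mul1g; apply: (autgroupP G).2. Qed.
Let GM x y : autset G x -> autset G y -> autset G (x * y).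
Proof. by move=> Gx /GV Gy; rewrite -[y]invgK; apply: (autgroupP G).2. Qed.

Let St1 : St 1. Proof. by split. Qed.
Let StV s : St s -> St s^-1.
Proof.
move=> [Gs sk]; split; first exact: GV.
by move=> w wk; rewrite -{1}(sk _ wk) actVK.
Qed.
Let StM s t : St s -> St t -> St (s * t).
Proof.
move=> [Gs sk] [Gt tk]; split; first exact: GM.
by move=> w wk; rewrite actM sk // tk.
Qed.
Let StJ s g : autset G g -> St s -> St (s ^ g).
Proof.
move=> Gg [Gs sk]; split; first by apply: GM; [exact: GV|exact: GM].
by move=> w wk; rewrite /conjg !actM sk ?size_act // actKV.
Qed.

Lemma quotP (C D : congr_quot) : quot_set C = quot_set D -> C = D.
Proof.
case: C D => C pC [D pD] /= E; subst D.
by rewrite (Prop_irrelevance pC pD).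
Qed.

Lemma St_coset_mem g : St_coset g g.
Proof. by exists 1; [exact: St1|rewrite mulg1]. Qed.

Lemma St_cosetE g h : autset G g -> autset G h ->
  St_coset g = St_coset h <-> (forall w, size w = k -> g w = h w).
Proof.
move=> Gg Gh; split=> [E w wk|E].
  have : St_coset h g by rewrite -E; exact: St_coset_mem.
  by move=> [s [_ sk] <-]; rewrite actM sk // size_act.
have Sgh : St (g^-1 * h).
  by split; [exact/GM/Gh/GV|move=> w wk; rewrite actM -E ?actKV ?size_act].
apply/seteqP; split=> _ [s Ss <-].
  exists ((g^-1 * h)^-1 * s); first by apply: StM => //; exact: StV.
  by rewrite invMg invgK !mulgA mulgV mul1g.
exists (g^-1 * h * s); first exact: StM.
by rewrite !mulgA mulgV mul1g.
Qed.

Lemma St_cosetM g h : autset G g -> autset G h ->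
  [set x * y | x in St_coset g & y in St_coset h]%classic = St_coset (g * h).
Proof.
move=> Gg Gh; apply/seteqP; split.
  move=> _ [_ [s Ss <-] [_ [t St' <-] <-]].
  exists (s ^ h * t); first by apply: StM => //; exact: StJ.
  by rewrite /conjg !mulgA mulgK.
move=> _ [s Ss <-]; exists g; first exact: St_coset_mem.
by exists (h * s); [exists s|rewrite mulgA].
Qed.

Lemma St_cosetV g : autset G g ->
  [set x^-1 | x in St_coset g]%classic = St_coset g^-1.
Proof.
move=> Gg; apply/seteqP; split.
  move=> _ [_ [s Ss <-] <-]; exists (s^-1 ^ g^-1).
    by apply: StJ; [exact: GV|exact: StV].
  by rewrite /conjg invgK invMg !mulgA mulVg mul1g.
move=> _ [s Ss <-]; exists (s^-1 * g); last by rewrite invMg invgK.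
exists (s^-1 ^ g); first by apply: StJ => //; exact: StV.
by rewrite /conjg !mulgA mulgV mul1g.
Qed.

Definition quot_proj_set g (Gg : autset G g) : congr_quot :=
  @CongrQuot (St_coset g) (ex_intro2 _ _ g Gg erefl).

Definition quot1 : congr_quot := quot_proj_set G1.

Definition quot_mul (C D : congr_quot) : congr_quot.
Proof.
refine (@CongrQuot [set x * y | x in quot_set C & y in quot_set D]%classic _).
have [g Gg ->] := quot_setP C; have [h Gh ->] := quot_setP D.
by exists (g * h); [exact: GM|exact: St_cosetM].
Defined.

Definition quot_inv (C : congr_quot) : congr_quot.
Proof.
refine (@CongrQuot [set x^-1 | x in quot_set C]%classic _).
have [g Gg ->] := quot_setP C.
by exists g^-1; [exact: GV|exact: St_cosetV].
Defined.

HB.instance Definition _ := gen_eqMixin congr_quot.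
HB.instance Definition _ := gen_choiceMixin congr_quot.

Lemma quot_mulA : associative quot_mul.
Proof.
move=> C D E; apply: quotP => /=.
have [f Gf ->] := quot_setP C; have [g Gg ->] := quot_setP D.
have [h Gh ->] := quot_setP E.
by rewrite !St_cosetM ?mulgA //; exact: GM.
Qed.
Lemma quot_mul1g : left_id quot1 quot_mul.
Proof.
move=> C; apply: quotP => /=; have [f Gf ->] := quot_setP C.
by rewrite St_cosetM ?mul1g.
Qed.
Lemma quot_mulg1 : right_id quot1 quot_mul.
Proof.
move=> C; apply: quotP => /=; have [f Gf ->] := quot_setP C.
by rewrite St_cosetM ?mulg1.
Qed.
Lemma quot_mulVg : left_inverse quot1 quot_inv quot_mul.
Proof.
move=> C; apply: quotP => /=; have [f Gf ->] := quot_setP C.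
by rewrite St_cosetV // St_cosetM ?mulVg //; exact: GV.
Qed.
Lemma quot_mulgV : right_inverse quot1 quot_inv quot_mul.
Proof.
move=> C; apply: quotP => /=; have [f Gf ->] := quot_setP C.
by rewrite St_cosetV // St_cosetM ?mulgV //; exact: GV.
Qed.

Let repr (C : congr_quot) : aut d := sval (cid2 (quot_setP C)).
Let reprP C : autset G (repr C) /\ quot_set C = St_coset (repr C).
Proof. by rewrite /repr; case: cid2. Qed.
Let level_act (C : congr_quot) : {ffun k.-tuple 'I_d -> k.-tuple 'I_d} :=
  [ffun w : k.-tuple 'I_d => insubd w (repr C w)].

Let level_act_inj : injective level_act.
Proof.
move=> C D /ffunP E; apply: quotP.
have [GC ->] := reprP C; have [GD ->] := reprP D.
apply/St_cosetE => // w /eqP wk.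
have := congr1 val (E (Tuple wk)).
by rewrite !ffunE !val_insubd !size_act !(eqP wk) eqxx.
Qed.

Let level_act_inv (F : {ffun k.-tuple 'I_d -> k.-tuple 'I_d}) :
  option congr_quot :=
  if pselect (exists C, level_act C = F) is left FP
  then Some (sval (cid FP)) else None.

Let level_actK : pcancel level_act level_act_inv.
Proof.
move=> C; rewrite /level_act_inv; case: pselect => [FP|[]]; last by exists C.
by case: cid => D /= /level_act_inj ->.
Qed.

HB.instance Definition _ := PCanIsCountable level_actK.
HB.instance Definition _ : isFinite congr_quot := PCanIsFinite level_actK.
HB.instance Definition _ := isGroup.Build congr_quot
  quot_mulA quot_mul1g quot_mulg1 quot_mulVg quot_mulgV.

End CongruenceQuotient.

Section GGS.
Variable n : nat.

Definition a_act (w : seq 'I_(2 ^ n)) : seq 'I_(2 ^ n) :=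
  if w is x :: w' then ordS x :: w' else [::].
Definition a_act_inv (w : seq 'I_(2 ^ n)) : seq 'I_(2 ^ n) :=
  if w is x :: w' then ord_pred x :: w' else [::].

Definition aut_a : aut (2 ^ n).
Proof.
refine (@Aut _ a_act a_act_inv _ _ _ _).
- by case=> //= x w; rewrite ordSK.
- by case=> //= x w; rewrite ord_predK.
- by case.
- by case=> [|x u] [|y v] //=; rewrite (inj_eq (@ordS_inj _)).
Defined.

Variable e : (2 ^ n).-1.-tuple 'Z_(2 ^ n).

(* The entry e_l, for 1 <= l <= 2^n - 1. *)
Definition entry (l : nat) : 'Z_(2 ^ n) := nth 0%R e l.-1.

(* As a has order 2^n, the exponent e_l may be read as its representative in nat.
   The letter x : 'I_(2^n) stands for l = x + 1, and the last letter for 2^n. *)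
Fixpoint b_act (w : seq 'I_(2 ^ n)) : seq 'I_(2 ^ n) :=
  if w is x :: w' then
    x :: (if (x.+1 < 2 ^ n)%N then (aut_a ^+ entry x.+1) w' else b_act w')
  else [::].
Fixpoint b_act_inv (w : seq 'I_(2 ^ n)) : seq 'I_(2 ^ n) :=
  if w is x :: w' then
    x :: (if (x.+1 < 2 ^ n)%N then (aut_a ^- entry x.+1) w' else b_act_inv w')
  else [::].

Definition aut_b : aut (2 ^ n).
Proof.
refine (@Aut _ b_act b_act_inv _ _ _ _).
- by elim=> //= x w IH; case: ifP => xn; rewrite xn ?actK ?IH.
- by elim=> //= x w IH; case: ifP => xn; rewrite xn ?act_invK ?IH.
- by elim=> //= x w IH; case: ifP => xn; rewrite ?size_act ?IH.
- elim=> [|x u IH] [|y v] //=; case: eqP => //= <-.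
  by case: ifP => _; rewrite ?IH ?prefix_act.
Defined.

(* psi(b) = (a^e_1, ..., a^e_(2^n-1), b) *)
Lemma aut_b_stab : stabilizer 1 aut_b.
Proof.
case=> [|x [|y w]] //= _; case: ifP => // _.
by rewrite (size0nil (size_act (aut_a ^+ entry x.+1) [::])).
Qed.

Lemma section_aut_b (x : 'I_(2 ^ n)) :
  section aut_b [:: x] =
  if (x.+1 < 2 ^ n)%N then aut_a ^+ entry x.+1 else aut_b.
Proof. by apply: autP => w; rewrite /= drop0; case: ifP. Qed.

Definition GGS : autgroup (2 ^ n) :=
  AutGroup (generated_subgroup [set aut_a; aut_b]%classic).

(* Divisibility by 2^t in the ring Z/2^nZ; for t >= n it means x = 0. *)
Definition pow2_dvd (t : nat) (x : 'Z_(2 ^ n)) : bool :=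
  [exists c : 'Z_(2 ^ n), x == (2%:R ^+ t * c)%R].

(* When R_j = n no l in the range is a multiple of 2^(R_j), and R_(j+1) = n. *)
Fixpoint R_ (j : nat) : nat :=
  let step := if j is j'.+1 then (2 ^ R_ j')%N else 1%N in
  (\max_(t < n.+1 | [forall l : 'I_(2 ^ n),
       (0 < l)%N && (step %| l) ==> pow2_dvd t (entry l)]) t)%N.

Definition S_ (k : nat) : 'Z_(2 ^ n) :=
  (\sum_(1 <= l < 2 ^ n | (2 ^ k %| l)%N) entry l)%R.

Definition is_m_rs (r s m : nat) : Prop :=
  if pow2_dvd (n - s) (S_ r) then m = 0%N else
  (1 <= m < n)%N /\ exists t : nat -> nat,
  [/\ (forall k, (k < m)%N -> (t k < n - s)%N) /\ (n - s <= t m)%N,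
      pow2_dvd (t 0%N) (S_ r) /\ ~~ pow2_dvd (t 0%N).+1 (S_ r),
      forall k, (1 <= k < m)%N ->
        pow2_dvd (t k) (S_ (t k.-1 + s)) /\
        ~~ pow2_dvd (t k).+1 (S_ (t k.-1 + s))
    & pow2_dvd (t m) (S_ (t m.-1 + s))].

Definition c_elt (q : nat) : aut (2 ^ n) :=
  [~ aut_a ^+ (2 ^ R_ q), aut_b, aut_a ^+ (2 ^ R_ q)] * aut_b.

(* The sections of f at level l other than the powers of a are all of the form
   (b^x)^(a^y). *)
Definition good_level (f : aut (2 ^ n)) (l : nat) : Prop :=
  forall u, size u = l ->
    ~ (exists z : int, section f u = expgz aut_a z) ->
    exists x y : int, section f u = expgz aut_b x ^ expgz aut_a y.

Definition is_lambda' (f : aut (2 ^ n)) (l : nat) : Prop :=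
  good_level f l /\ forall l', good_level f l' -> (l <= l')%N.

(* m_G as a definite description: every ingredient is determined by e, up to
   the choice of q, which does not affect R_q. *)
Definition is_m_G (mG : nat) : Prop :=
  exists q d l m00 m10,
  [/\ (1 <= q <= n.-1)%N /\ (R_ q = R_ q.+1 /\ (R_ q < n)%N),
      has_order (c_elt q) (2 ^ d),
      is_lambda' (c_elt q ^+ (2 ^ d.-1)) l,
      is_m_rs 0 0 m00 /\ is_m_rs 1 0 m10
    & mG = (maxn (m00 + l) m10 + 3)%N].

End GGS.

Section MixedBeauville.
Variable gT : finGroupType.
Implicit Types (H M : {group gT}) (x y : gT).

Definition Sigma M x y : {set gT} :=
  \bigcup_(g in M) (<[x]> :^ g :|: <[y]> :^ g :|: <[x * y]> :^ g).

Definition mixed_Beauville_structure H M x y : Prop :=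
  [/\ M \subset H /\ #|H : M| = 2,
      M :=: <<[set x; y]>>,
      exists2 h0, h0 \in H :\: M & (Sigma M x y :^ h0) :&: Sigma M x y = [set 1]
    & forall h, h \in H :\: M -> h ^+ 2 \notin Sigma M x y].

Definition admits_mixed_Beauville H : Prop :=
  exists M x y, mixed_Beauville_structure H M x y.

End MixedBeauville.

(* Main.v *)
Require Import Defs.
From mathcomp Require Import all_boot all_order all_fingroup all_algebra.
From mathcomp Require Import boolp classical_sets cardinality.
From mathcomp Require Import ring zify.
(* The names aut, act and actM are also those of MathComp's group actions. *)
Import Defs.

(* Write a word for an element g of G as (i, F), where i in Z/2^n is its total
   exponent in a and the polynomial F in Z[x]/(x^(2^n) - 1) records the
   exponents in b of its first-level sections. The labels of g on the first level
   are the product of F with the defining vector e. If g fixes level 2, this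
   product is 0, so F(1) is even: Z/2^n[x]/(x^(2^n) - 1) is a local ring, in which
   an element of odd augmentation is a unit, and e <> 0. Hence, if g fixes level
   3, all coefficients of F are even; writing F = 2 K, the element K kills 2e,
   so that F(1) = 0 mod 4 unless 2e = 0.

   Let now k >= 3 and H = G/St_G(k). By the above i, the classes of F(1) and F'(1)
   (the derivative) mod 2 and, unless 2e = 0, that of F(1) mod 4, only depend on
   the image of the word in H. These invariants yield a homomorphism of M onto
   (Z/2)^3, so that M cannot be generated by two elements, for each subgroup M of
   index 2 when 2e <> 0, and for the one containing b when 2e = 0. If 2e = 0, then
   b is an involution, and it lies in M since squares of elements outside M avoid
   the identity. *)

Set Implicit Arguments.
Unset Strict Implicit.
Unset Printing Implicit Defensive.

Import GRing.Theory.
Local Open Scope ring_scope.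

(** * Residues modulo 2^n *)

Section Modulus.
Variable n : nat.
Hypothesis n_ge2 : (2 <= n)%N.
Local Notation Z := 'Z_(2 ^ n).
Implicit Types (t z i u : Z) (F c : Z -> Z).

(** Multiplication by [quarter_mod] or [half_mod] embeds the residues modulo 4 or modulo 2 into [Z],
    so that such congruences become equations in one ring. *)
Definition quarter_mod : Z := 2 ^+ n.-2.
Definition half_mod : Z := 2 * quarter_mod.

Lemma modulus_gt1 : (1 < 2 ^ n)%N.
Proof. by rewrite -{1}(expn0 2) ltn_exp2l //; lia. Qed.

Lemma pow2_modulus : 2 ^+ n = 0 :> Z.
Proof. by rewrite -natrX pchar_Zp ?modulus_gt1. Qed.

Lemma halfE : half_mod = (2 ^ n.-1)%:R.
Proof. by rewrite /half_mod /quarter_mod -exprS natrX; congr (_ ^+ _); lia. Qed.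

Lemma double_half : 2 * half_mod = 0.
Proof.
by rewrite halfE natrX -exprS prednK ?pow2_modulus //; lia.
Qed.

Lemma natr_Z_eq0 m : (m%:R == 0 :> Z) = (2 ^ n %| m)%N.
Proof. by rewrite -val_eqE /= val_Zp_nat ?modulus_gt1. Qed.

Lemma half_mul_eq0 t : (half_mod * t == 0) = ~~ odd t.
Proof.
rewrite halfE -{1}(natr_Zp t) -natrM natr_Z_eq0.
by rewrite -{1}(prednK (ltnW n_ge2)) expnSr dvdn_pmul2l ?expn_gt0 // dvdn2.
Qed.

Lemma half_neq0 : half_mod != 0.
Proof. by rewrite -[half_mod]mulr1 half_mul_eq0. Qed.

Lemma half_mul0_double t : half_mod * t = 0 -> exists s, t = 2 * s.
Proof.
move/eqP; rewrite half_mul_eq0 => ev; exists (t./2)%:R.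
by rewrite -natrM mul2n halfK (negPf ev) subn0 natr_Zp.
Qed.

Lemma half_mul_unit t : half_mod * t != 0 -> t \is a GRing.unit.
Proof.
rewrite half_mul_eq0 negbK => od.
by rewrite -[t]natr_Zp unitZpE ?modulus_gt1 // coprimeXl // coprime2n.
Qed.

Lemma half_mul_neq0_succ_double t :
  half_mod * t != 0 -> exists s, t = 1 + 2 * s.
Proof.
rewrite half_mul_eq0 negbK => od; exists (t./2)%:R.
by rewrite -[LHS]natr_Zp -{1}(odd_double_half t) od natrD -mul2n natrM.
Qed.

Lemma half_mulB1 t : half_mod * (t * t - t) = 0.
Proof.
have [/half_mul0_double[s ->]|] := eqVneq (half_mod * t) 0.
  transitivity (2 * half_mod * (s * (2 * s) - s)); first ring.
  by rewrite double_half mul0r.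
move=> /half_mul_neq0_succ_double[s ->].
transitivity (2 * half_mod * (s * (1 + 2 * s))); first ring.
by rewrite double_half mul0r.
Qed.

Lemma half_mul_cases t : half_mod * t = 0 \/ half_mod * t = half_mod.
Proof.
have [->|] := eqVneq (half_mod * t) 0; first by left.
move=> /half_mul_neq0_succ_double[s ->]; right.
by rewrite mulrDr mulr1 mulrCA mulrA double_half // mul0r addr0.
Qed.

(** Parity is additive; this form matches the membership rule [index2_memM] for a subgroup of index
    2. *)
Lemma half_mulD_eq0 t s :
  (half_mod * (t + s) == 0) = ((half_mod * t == 0) == (half_mod * s == 0)).
Proof.
have h0 := negPf half_neq0; rewrite mulrDr.
have hh : half_mod + half_mod = 0 by rewrite -double_half; ring.
by case: (half_mul_cases t) => ->; case: (half_mul_cases s) => ->;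
   rewrite ?addr0 ?add0r ?hh ?h0 ?eqxx.
Qed.

Definition diff c u := c (u + 1) - c u.

(** [diff] is T - 1 for the unit shift T, and modulo 2 the Frobenius identity gives (T - 1)^(2^k) =
    T^(2^k) - 1. *)
Lemma iter_diff_pow2 k c : (forall u, 2 * c u = 0) ->
  forall u, iter (2 ^ k) diff c u = c (u + 2 ^+ k) - c u.
Proof.
elim: k c => [|k IH] c c2 u //.
rewrite expnS mul2n -addnn iterD IH => [|{}u].
  rewrite !IH //.
  have -> : u + 2 ^+ k + 2 ^+ k = u + 2 ^+ k.+1 by rewrite exprS; ring.
  have -> : forall x y z : Z, x - y - (y - z) = x - z - 2 * y + 2 * z.
    by move=> x y w; ring.
  by rewrite !c2; ring.
by rewrite IH // mulrBr !c2 subrr.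
Qed.

Definition conv F c z := \sum_u F (z + u) * c u.

(** Shifting [c] shifts the argument of the convolution, so the functions [c] with zero convolution
    are stable under [diff]. *)
Lemma conv_diff F c z : conv F (diff c) z = conv F c (z - 1) - conv F c z.
Proof.
rewrite /conv -sumrB (eq_bigr (fun u => F (z + u) * c (u + 1) - F (z + u) * c u)).
  rewrite !sumrB; congr (_ - _).
  rewrite [RHS](reindex_inj (addIr 1)) /=.
  by apply: eq_bigr => u _; congr (F _ * _); ring.
by move=> u _; rewrite -mulrBr.
Qed.

(* Multiplication by 2 and diff act nilpotently, which reduces the claim to a
   constant function c, where F acts as the unit F(1). *)
Lemma conv_reg F c : half_mod * \sum_u F u != 0 ->
  (forall z, conv F c z = 0) -> forall u, c u = 0.
Proof.
move=> /half_mul_unit Funit.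
have nilp j : forall c, (forall u, iter j diff c u = 0) ->
    (forall z, conv F c z = 0) -> forall u, c u = 0.
  elim: j => [|j IH] {}c dc cF //.
  have dc0 u : diff c u = 0.
    by apply: IH => [{}u|z]; rewrite -?iterSr // conv_diff !cF subrr.
  have cst u : c u = c 0.
    rewrite -[u]natr_Zp; elim: (nat_of_ord u) => // m Em.
    by apply/eqP; rewrite -Em -subr_eq0 mulrSr; apply/eqP/dc0.
  move=> u; rewrite cst; have := cF 0; rewrite /conv.
  under eq_bigr => w _ do rewrite cst add0r.
  by rewrite -mulr_suml => /(congr1 (fun z => (\sum_u F u)^-1 * z));
     rewrite mulKr // mulr0.
have two m : forall c, (forall u, 2 ^+ m * c u = 0) ->
    (forall z, conv F c z = 0) -> forall u, c u = 0.
  elim: m => [|m IH] {}c c2 cF u; first by rewrite -[c u]mul1r c2.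
  (* By induction 2 c = 0, so [diff] iterated 2^n times is the shift by 2^n minus the identity,
     which vanishes since 2^n = 0 in [Z]. *)
  apply: (nilp (2 ^ n)%N) => // {}u.
  rewrite iter_diff_pow2 ?pow2_modulus ?addr0 ?subrr // => {}u.
  apply: (IH (fun u => 2 * c u)) => [{}u|z]; first by rewrite mulrA -exprSr.
  have <- : 2 * conv F c z = conv F (fun u => 2 * c u) z.
    by rewrite /conv mulr_sumr; apply: eq_bigr => w _; ring.
  by rewrite cF mulr0.
by apply: (two n) => u; rewrite pow2_modulus mul0r.
Qed.

End Modulus.

(** * Exponents of words and of their sections *)

Section Track.
Variables (n : nat) (e : (2 ^ n).-1%N.-tuple 'Z_(2 ^ n)).
Hypothesis n_ge2 : (2 <= n)%N.
Local Notation Z := 'Z_(2 ^ n).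
Local Notation a := (aut_a n).
Local Notation b := (aut_b e).
Implicit Types (g h : aut (2 ^ n)) (x : 'I_(2 ^ n)) (i z : Z) (F : Z -> Z).

(** The letter read as z carries the entry of index z + 1. At the last letter the section of b is b
    itself, a word of total exponent 0 in a, hence the value 0. *)
Definition label_b z : Z := if (z.+1 < 2 ^ n)%N then entry e z.+1 else 0.

(* [track g i F]: the element g of G is given as a word in a and b, of total
   exponent i in a, whose section at the letter z has total exponent F z in b;
   the letter x of 'I_(2^n) is read as the residue x%:R. *)
Inductive track : aut (2 ^ n) -> Z -> (Z -> Z) -> Prop :=
| track1 : track 1%g 0 (fun=> 0)
| track_a : track a 1 (fun=> 0)
| track_b : track b 0 (fun z => (z == -1)%:R)
| trackM g h i j F K of track g i F & track h j K :
    track (g * h)%g (i + j) (fun z => F z + K (z + i))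
| trackV g i F of track g i F : track g^-1%g (- i) (fun z => - F (z - i)).

Lemma track_GGS g i F : track g i F -> autset (GGS e) g.
Proof.
have [G1 GMV] := autgroupP (GGS e).
have GV h : autset (GGS e) h -> autset (GGS e) h^-1%g.
  by move=> Gh; rewrite -[(h^-1)%g]mul1g; apply: GMV.
elim=> {g i F} [||| g h i j F K _ Gg _ Gh | g i F _ /GV //] //.
- by move=> K [_]; apply; left.
- by move=> K [_]; apply; right.
by rewrite -[h]invgK; apply: GMV => //; apply: GV.
Qed.

Lemma GGS_track g : autset (GGS e) g -> exists i F, track g i F.
Proof.
move/(_ [set g | exists i F, track g i F]%classic); apply; split; last first.
  by move=> _ [->|->]; [exists 1|exists 0]; eexists; [exact: track_a|exact: track_b].
split; first by exists 0; eexists; exact: track1.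
move=> g1 g2 [i [F T1]] [j [K T2]].
by eexists; eexists; exact: (trackM T1 (trackV T2)).
Qed.

Lemma track_aX m : track (a ^+ m)%g m%:R (fun=> 0).
Proof.
elim: m => [|m IH]; first exact: track1.
rewrite expgSr mulrSr; have := trackM IH track_a.
by rewrite (_ : (fun=> _) = (fun=> 0)) //; apply/funext => z; rewrite addr0.
Qed.

Lemma letter_inj : injective (fun x => (x%:R : Z)).
Proof.
move=> x y /(congr1 val) /=; rewrite !val_Zp_nat ?modulus_gt1 //.
by rewrite !modn_small ?ltn_ord // => /val_inj.
Qed.

Lemma letter_surj z : exists x, x%:R = z.
Proof.
have lt : (z < 2 ^ n)%N.
  by have := ltn_ord z; rewrite [X in (_ < X)%N]Zp_cast ?modulus_gt1.
by exists (Ordinal lt); rewrite natr_Zp.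
Qed.

Lemma track_letter g i F : track g i F ->
  forall x, exists2 y, g [:: x] = [:: y] & y%:R = x%:R + i.
Proof.
elim=> {g i F} [||| g h i j F K _ IHg _ IHh | g i F _ IHg] x.
- by exists x; rewrite ?addr0.
- exists (ordS x) => //=.
  by rewrite Zp_nat_mod ?modulus_gt1 // mulrSr.
- by exists x; rewrite ?addr0 // aut_b_stab.
- have [y gx yE] := IHg x; have [w hy wE] := IHh y.
  by exists w; [rewrite actM gx hy|rewrite wE yE addrA].
case E: (g^-1%g [:: x]) (size_act g^-1%g [:: x]) => [|y [|]] // _.
have [w gy wE] := IHg y; exists y => //.
by move: gy; rewrite -E actKV => -[->]; rewrite wE addrK.
Qed.

Lemma section1 u : section (1%g : aut (2 ^ n)) u = 1%g.
Proof. by apply: autP => w /=; rewrite drop_size_cat. Qed.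

Lemma sectionM g h u : section (g * h)%g u = (section g u * section h (g u))%g.
Proof.
apply: autP => w; have := sectionE (g * h)%g u w.
rewrite !actM (sectionE g) (sectionE h).
by move/eqP; rewrite eqseq_cat ?eqxx // => /andP[_ /eqP].
Qed.

Lemma sectionV g u : section g^-1%g u = (section g (g^-1%g u))^-1%g.
Proof.
by apply: (mulIg (section g (g^-1%g u))); rewrite -sectionM !mulVg section1.
Qed.

(* A word for g yields words for its sections, whose root labels are the
   convolution of F with the labels of b. *)
Lemma track_section g i F : track g i F -> forall x,
  exists j K, [/\ track (section g [:: x]) j K,
    j = conv F (fun u => label_b (-1 - u)) x%:R & \sum_u K u = F x%:R].
Proof.
rewrite /conv.
elim=> {g i F} [||| g h i j F K Tg IHg Th IHh | g i F Tg IHg] x.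
- exists 0, (fun=> 0); rewrite section1 sumr_const mul0rn.
  split=> //; first exact: track1.
  by rewrite big1 // => u _; rewrite mul0r.
- exists 0, (fun=> 0); rewrite sumr_const mul0rn.
  split=> //; last by rewrite big1 // => u _; rewrite mul0r.
  by rewrite (_ : section _ _ = 1%g); [exact: track1|apply: autP => w /=; rewrite drop0].
- rewrite section_aut_b.
  (* Only u = -1 - x contributes, because b has its section b at the last letter, read as -1. *)
  have -> : \sum_u (x%:R + u == -1)%:R * label_b (-1 - u) = label_b x%:R.
    rewrite (bigD1 (-1 - x%:R)) //= big1 => [|u].
      rewrite (_ : x%:R + (-1 - x%:R) = -1) ?eqxx ?mul1r ?addr0; last by ring.
      by congr (label_b _); ring.
    by rewrite -subr_eq0 => H; rewrite -subr_eq0 (_ : _ - _ = u - (-1 - x%:R));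
       [rewrite (negPf H) mul0r|ring].
  have xE : (x%:R : Z) = x :> nat.
    by rewrite val_Zp_nat ?modulus_gt1 // modn_small.
  have x1 : ((x%:R : Z) == -1) = ~~ (x.+1 < 2 ^ n)%N.
    rewrite -subr_eq0 opprK -mulrSr natr_Z_eq0 //.
    have := ltn_ord x; rewrite leq_eqVlt => /orP[/eqP->|lt].
      by rewrite dvdnn ltnn.
    by rewrite lt gtnNdvd.
  rewrite /label_b xE x1; case: ifP => xn.
    exists (entry e x.+1), (fun=> 0); rewrite sumr_const mul0rn; split=> //.
    by rewrite -{2}[entry e x.+1]natr_Zp; exact: track_aX.
  exists 0, (fun z => (z == -1)%:R); split=> //; first exact: track_b.
  by rewrite (bigD1 (-1)) //= big1 ?eqxx ?addr0 // => u /negPf->.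
- have [y gx yE] := track_letter Tg x.
  have [j1 [K1 [T1 E1 s1]]] := IHg x; have [j2 [K2 [T2 E2 s2]]] := IHh y.
  rewrite sectionM gx; eexists; eexists; split; first exact: (trackM T1 T2).
    rewrite E1 E2 -big_split; apply: eq_bigr => u _ /=.
    by rewrite yE mulrDl; congr (_ + K _ * _); ring.
  rewrite big_split s1 /= -yE -s2; congr (_ + _).
  by rewrite [RHS](reindex_inj (addIr j1)).
have [y gx yE] := track_letter (trackV Tg) x.
have [j1 [K1 [T1 E1 s1]]] := IHg y.
rewrite sectionV gx; eexists; eexists; split; first exact: (trackV T1).
  rewrite E1 -sumrN; apply: eq_bigr => u _ /=.
  by rewrite yE mulNr; congr (- (F _ * _)); ring.
rewrite sumrN -yE -s1; congr (- _).
by rewrite [RHS](reindex_inj (addIr (- j1))).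
Qed.

End Track.

(** * Congruences for the exponents of elements of level stabilizers *)

Section Stabilizers.
Variables (n : nat) (e : (2 ^ n).-1%N.-tuple 'Z_(2 ^ n)).
Hypothesis n_ge2 : (2 <= n)%N.
Local Notation Z := 'Z_(2 ^ n).
Local Notation a := (aut_a n).
Local Notation b := (aut_b e).
Implicit Types (g h : aut (2 ^ n)) (x : 'I_(2 ^ n)) (i d t z : Z) (F : Z -> Z).

Lemma stabilizer_le k l g : (l <= k)%N -> stabilizer k g -> stabilizer l g.
Proof.
move=> lk gk w wl; have [x _] := letter_surj n_ge2 0.
have sz : size (w ++ nseq (k - l) x) = k by rewrite size_cat size_nseq wl subnKC.
by move/eqP: (gk _ sz); rewrite act_cat eqseq_cat ?size_act // => /andP[/eqP].
Qed.

Lemma stabilizer_section k g x :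
  stabilizer k.+1 g -> stabilizer k (section g [:: x]).
Proof.
move=> gk w wk; have g1 : g [:: x] = [:: x] by apply: (stabilizer_le (ltn0Sn k) gk).
have := sectionE g [:: x] w; rewrite g1 gk => [[]|]; last by rewrite /= wk.
by move/esym.
Qed.

Lemma track_stabilizer1 g i F : track e g i F -> stabilizer 1 g -> i = 0.
Proof.
move=> Tg g1; have [x x0] := letter_surj n_ge2 0.
have [y] := track_letter n_ge2 Tg x; rewrite g1 // => -[<-].
by rewrite x0 add0r => <-.
Qed.

Lemma track_stabilizer2 g i F : track e g i F -> stabilizer 2 g ->
  forall z, conv F (fun u => label_b e (-1 - u)) z = 0.
Proof.
move=> Tg g2 z; have [x <-] := letter_surj n_ge2 z.
have [j [K [Tx <- _]]] := track_section n_ge2 Tg x.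
exact/(track_stabilizer1 Tx)/stabilizer_section.
Qed.

Hypothesis e_neq0 : exists z, label_b e z != 0.

(** An odd F(1) would make convolution with F injective, and the vanishing of the first-level labels
    of g would force all labels of b to be 0. *)
Lemma half_sum_stabilizer2 g i F : track e g i F -> stabilizer 2 g ->
  half_mod n * \sum_u F u = 0.
Proof.
move=> Tg /(track_stabilizer2 Tg) cF; apply/eqP/negPn/negP => odd_sum.
have [z /eqP[]] := e_neq0.
by have := conv_reg n_ge2 odd_sum cF (-1 - z); rewrite opprB addrC subrK.
Qed.

(** The section at x fixes level 2 and its own polynomial has total F(x), so [half_sum_stabilizer2]
    applies to each section. *)
Lemma half_stabilizer3 g i F : track e g i F -> stabilizer 3 g ->
  forall z, half_mod n * F z = 0.
Proof.
move=> Tg g3 z; have [x <-] := letter_surj n_ge2 z.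
have [j [K [Tx _ <-]]] := track_section n_ge2 Tg x.
exact/(half_sum_stabilizer2 Tx)/stabilizer_section.
Qed.

Lemma quarter_sum_stabilizer3 g i F : track e g i F -> stabilizer 3 g ->
  (exists z, 2 * label_b e z != 0) -> quarter_mod n * \sum_u F u = 0.
Proof.
move=> Tg g3 [z /eqP e2].
have cF := track_stabilizer2 Tg (stabilizer_le (leqnSn 2) g3).
have [K FK] :=
  boolp.choice (fun u => half_mul0_double n_ge2 (half_stabilizer3 Tg g3 u)).
have -> : quarter_mod n * \sum_u F u = half_mod n * \sum_u K u.
  rewrite (eq_bigr (fun u => 2 * K u)) // -mulr_sumr /half_mod; ring.
apply/eqP/negPn/negP => odd_sum; case: e2.
(* The factor 2 moves from F to the labels: K convolves the doubled labels to 0. *)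
have := conv_reg (c := fun u => 2 * label_b e (-1 - u)) n_ge2 odd_sum _ (-1 - z).
rewrite opprB addrC subrK; apply => u; rewrite -[RHS](cF u).
by apply: eq_bigr => w _; rewrite FK; ring.
Qed.

(* [exponents g i d t]: the image in Z^3 of a word (i, F) for g, where d and t
   are the value at 1 of the derivative of the polynomial F and F(1). *)
Definition exponents g i d t := exists F,
  [/\ track e g i F, d = \sum_z z * F z & t = \sum_z F z].

Lemma exponents_a : exponents a 1 0 0.
Proof.
exists (fun=> 0); split; first exact: track_a; last by rewrite big1.
by rewrite big1 // => z _; rewrite mulr0.
Qed.

Lemma exponents_b : exponents b 0 (-1) 1.
Proof.
exists (fun z => (z == -1)%:R); split; first exact: track_b.
  rewrite (bigD1 (-1)) //= big1 ?eqxx ?addr0 ?mulr1 // => u /negPf->.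
  by rewrite mulr0.
by rewrite (bigD1 (-1)) //= big1 ?eqxx ?addr0 // => u /negPf->.
Qed.

(** This is the multiplication of a Heisenberg group over [Z]: substituting z - i for z in the sum
    of the z K(z + i) gives c - i s. *)
Lemma exponentsM g h i d t j c s : exponents g i d t -> exponents h j c s ->
  exponents (g * h)%g (i + j) (d + c - i * s) (t + s).
Proof.
move=> [F [Tg -> ->]] [K [Th -> ->]]; eexists; split; first exact: trackM Tg Th.
  rewrite -addrA mulr_sumr -sumrB.
  rewrite [X in _ + X](reindex_inj (addIr i)) -big_split /=.
  by apply: eq_bigr => z _; ring.
by rewrite [X in _ + X](reindex_inj (addIr i)) -big_split.
Qed.

Lemma exponentsV g i d t : exponents g i d t ->
  exponents g^-1%g (- i) (- (d + i * t)) (- t).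
Proof.
move=> [F [Tg -> ->]]; eexists; split; first exact: trackV Tg.
  rewrite mulr_sumr -big_split -sumrN /= (reindex_inj (addIr (- i))).
  by apply: eq_bigr => z _ /=; ring.
by rewrite -sumrN (reindex_inj (addIr (- i))).
Qed.

Lemma exponents_stabilizer3 g i d t : exponents g i d t -> stabilizer 3 g ->
  [/\ i = 0, half_mod n * d = 0, half_mod n * t = 0
    & (exists z, 2 * label_b e z != 0) -> quarter_mod n * t = 0].
Proof.
move=> [F [Tg -> ->]] g3; split.
- exact: track_stabilizer1 Tg (stabilizer_le _ g3).
- rewrite mulr_sumr big1 // => z _.
  by rewrite mulrCA (half_stabilizer3 Tg g3) mulr0.
- by rewrite mulr_sumr big1 // => z _; apply: half_stabilizer3 Tg g3 z.
exact: quarter_sum_stabilizer3 Tg g3.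
Qed.

Lemma exponents_level g h i d t j c s k : (3 <= k)%N ->
  exponents g i d t -> exponents h j c s ->
  (forall w, size w = k -> g w = h w) ->
  [/\ i = j, half_mod n * d = half_mod n * c, half_mod n * t = half_mod n * s
    & (exists z, 2 * label_b e z != 0) -> quarter_mod n * t = quarter_mod n * s].
Proof.
move=> k3 Eg Eh gh.
have st : stabilizer 3 (g * h^-1)%g.
  by apply: stabilizer_le k3 _ => w wk; rewrite actM gh // actVK.
have [i0 d0 t0 q0] := exponents_stabilizer3 (exponentsM Eg (exponentsV Eh)) st.
have ij : i = j by apply/subr0_eq.
(* With i = j the cross terms cancel, and the second exponent of g h^-1 is d - c. *)
subst j; split=> //.
- by apply/subr0_eq; rewrite -[RHS]d0; ring.
- by apply/subr0_eq; rewrite -[RHS]t0; ring.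
by move=> /q0 q; apply/subr0_eq; rewrite -[RHS]q; ring.
Qed.

End Stabilizers.

(** * Subgroups of index 2 *)

Lemma index2_memM (gT : finGroupType) (H M : {group gT}) (u v : gT) :
  M \subset H -> #|H : M|%g = 2%N -> u \in H -> v \in H ->
  ((u * v)%g \in M) = ((u \in M) == (v \in M)).
Proof.
move=> sMH iM Hu Hv.
have [Mu|Mu] := boolP (u \in M); first by rewrite groupMl //; case: (v \in M).
have [Mv|Mv] := boolP (v \in M); first by rewrite groupMr // (negPf Mu).
have HMv : (v^-1)%g \in H :\: M by rewrite inE !groupV Mv.
have : u \in H :\: M by rewrite inE Mu.
by rewrite -(rcoset_index2 sMH iM HMv) mem_rcoset invgK => ->.
Qed.

(** An elementary abelian 2-group generated by two elements has at most four elements. Additivity is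
    asked on M alone, because the maps used later are additive only there. *)
Lemma elementary_gen2 (gT : finGroupType) (A : zmodType) (f : gT -> A)
    (M : {group gT}) (x y : gT) :
  M :=: <<[set x; y]>>%g ->
  {in M &, forall u v, f (u * v)%g = f u + f v} ->
  {in M, forall u, f u *+ 2 = 0} ->
  {in M, forall u, f u \in [:: 0; f x; f y; f x + f y]}.
Proof.
move=> defM fM f2.
have [Mx My] : x \in M /\ y \in M by rewrite defM !mem_gen // !inE eqxx ?orbT.
have span : {in M, forall u, exists p q : nat, f u = f x *+ p + f y *+ q}.
  (* The elements of M with value in the span of f x and f y form a subgroup containing x and y. *)
  move=> u Mu; pose B := [set u in M | `[< exists p q : nat, f u = f x *+ p + f y *+ q >]].
  have gB : group_set B.
    apply/group_setP; split.
      rewrite inE group1; apply/asboolP; exists 0%N, 0%N; rewrite addr0.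
      by apply: (addrI (f 1%g)); rewrite -fM ?group1 // mulg1 addr0.
    move=> v w; rewrite !inE => /andP[Mv /asboolP[p [q E]]].
    move=> /andP[Mw /asboolP[r [s E']]]; rewrite groupM //; apply/asboolP.
    by exists (p + r)%N, (q + s)%N; rewrite fM // E E' !mulrnDr addrACA.
  have sMB : M \subset Group gB.
    rewrite defM gen_subG; apply/fintype.subsetP => v; rewrite !inE => /orP[]/eqP->;
      rewrite ?Mx ?My; apply/asboolP.
      by exists 1%N, 0%N; rewrite addr0.
    by exists 0%N, 1%N; rewrite add0r.
  by have := fintype.subsetP sMB u Mu; rewrite inE => /andP[_ /asboolP].
have red v p : v \in M -> f v *+ p = f v *+ odd p.
  move=> Mv; rewrite -{1}(odd_double_half p) mulrnDr -muln2 mulnC mulrnA.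
  by rewrite f2 // mul0rn addr0.
move=> u /span[p [q ->]]; rewrite (red x) // (red y) // !inE.
by case: (odd p); case: (odd q); rewrite ?mulr0n ?mulr1n ?add0r ?addr0 ?eqxx ?orbT.
Qed.

(** * Exponents in the congruence quotient and characters of order 2 *)

Section Quotient.
Variables (n : nat) (e : (2 ^ n).-1%N.-tuple 'Z_(2 ^ n)) (k : nat).
Hypothesis n_ge2 : (2 <= n)%N.
Hypothesis k_ge3 : (3 <= k)%N.
Hypothesis e_neq0 : exists z, label_b e z != 0.
Local Notation Z := 'Z_(2 ^ n).
Local Notation a := (aut_a n).
Local Notation b := (aut_b e).
Local Notation H := (congr_quot (GGS e) k).
Implicit Types (C D : H) (i d t : Z).

(** A relation, since a coset is represented by many words; [coset_exponents_uniq] states which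
    reductions of the exponents it determines. *)
Definition coset_exponents C i d t := exists g,
  quot_set C = St_coset (GGS e) k g /\ exponents e g i d t.

Lemma exponents_GGS g i d t : exponents e g i d t -> autset (GGS e) g.
Proof. by case=> F [/track_GGS]. Qed.

Lemma GGS_exponents g : autset (GGS e) g -> exists i d t, exponents e g i d t.
Proof. by move=> /GGS_track[i [F T]]; exists i; do 2!eexists; exists F. Qed.

Lemma coset_exponents_ex C : exists i d t, coset_exponents C i d t.
Proof.
have [g /GGS_exponents[i [d [t E]]] Cg] := quot_setP C.
by exists i, d, t, g.
Qed.

Lemma exponents_coset g i d t : exponents e g i d t ->
  exists2 C : H, quot_set C = St_coset (GGS e) k g & coset_exponents C i d t.
Proof.
move=> E; exists (quot_proj_set k (exponents_GGS E)) => //.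
by exists g.
Qed.

Lemma coset_exponentsM C D i d t j c s :
  coset_exponents C i d t -> coset_exponents D j c s ->
  coset_exponents (C * D)%g (i + j) (d + c - i * s) (t + s).
Proof.
move=> [g [Cg Eg]] [h [Dh Eh]]; exists (g * h)%g; split; last exact: exponentsM.
by rewrite /= Cg Dh St_cosetM //; [exact: exponents_GGS Eg|exact: exponents_GGS Eh].
Qed.

Lemma coset_exponents_uniq C i d t j c s :
  coset_exponents C i d t -> coset_exponents C j c s ->
  [/\ i = j, half_mod n * d = half_mod n * c, half_mod n * t = half_mod n * s
    & (exists z, 2 * label_b e z != 0) -> quarter_mod n * t = quarter_mod n * s].
Proof.
move=> [g [Cg Eg]] [h [Ch Eh]].
apply: (exponents_level n_ge2 e_neq0 k_ge3 Eg Eh).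
apply/St_cosetE; [exact: exponents_GGS Eg|exact: exponents_GGS Eh|].
by rewrite -Cg.
Qed.

(** M is the kernel of a character with values in Z/2. Its values p and q at the classes of a and b
    determine it on every word through the total exponents i and t, by induction on the word. *)
Lemma index2_linear (M : {group H}) : #|[set: H] : M|%g = 2%N ->
  exists p q : bool, p || q /\ forall C i d t, coset_exponents C i d t ->
      (C \in M) = (half_mod n * (p%:R * i + q%:R * t) == 0).
Proof.
move=> iM; have [A Aa _] := exponents_coset (exponents_a e).
have [B Bb _] := exponents_coset (exponents_b e).
have h0 := negPf (half_neq0 n_ge2).
exists (A \notin M), (B \notin M).
have main g i F : track e g i F -> forall C, quot_set C = St_coset (GGS e) k g ->
    (C \in M) = (half_mod n * ((A \notin M)%:R * i + (B \notin M)%:R * \sum_z F z) == 0).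
  elim=> {g i F} [||| g h i j F K Tg IHg Th IHh | g i F Tg IHg] C Cg.
  - have -> : C = 1%g by apply: quotP; rewrite Cg.
    by rewrite group1 big1 // !(mulr0, addr0) eqxx.
  - have -> : C = A by apply: quotP; rewrite Cg Aa.
    rewrite big1 // mulr1 mulr0 addr0.
    by case: (A \in M); rewrite /= ?mulr1 ?mulr0 ?eqxx ?h0.
  - have -> : C = B by apply: quotP; rewrite Cg Bb.
    rewrite (bigD1 (-1)) //= big1 ?eqxx => [|u /negPf->//].
    rewrite mulr0 add0r addr0 mulr1.
    by case: (B \in M); rewrite /= ?mulr1 ?mulr0 ?eqxx ?h0.
  - pose D := quot_proj_set k (track_GGS Tg); pose E := quot_proj_set k (track_GGS Th).
    have -> : C = (D * E)%g.
      by apply: quotP; rewrite Cg /= St_cosetM //;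
         [exact: track_GGS Tg|exact: track_GGS Th].
    rewrite (index2_memM (finset.subsetT M) iM) ?inE // (IHg D) // (IHh E) //.
    have -> : \sum_z (F z + K (z + i)) = \sum_z F z + \sum_z K z.
      by rewrite big_split [X in _ = _ + X](reindex_inj (addIr i)).
    by rewrite -half_mulD_eq0 //; congr (_ * _ == _); ring.
  pose D := quot_proj_set k (track_GGS Tg).
  have -> : C = (D^-1)%g.
    by apply: quotP; rewrite Cg /= St_cosetV //; apply: track_GGS Tg.
  have -> : \sum_z - F (z - i) = - \sum_z F z.
    by rewrite sumrN [in RHS](reindex_inj (addIr (- i))).
  by rewrite groupV (IHg D) // !mulrN -opprD mulrN oppr_eq0.
split; last first.
  by move=> C i d t [g [Cg [F [Tg _ ->]]]]; apply: main Tg C Cg.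
(* If M contained both classes it would be the whole quotient, of index 1. *)
rewrite -negb_and; apply/negP => /andP[MA MB].
have defM : M :=: [set: H].
  apply/eqP; rewrite finset.eqEsubset finset.subsetT /=; apply/fintype.subsetP => C _.
  have [i [d [t [g [Cg [F [Tg _ _]]]]]]] := coset_exponents_ex C.
  by rewrite (main _ _ _ Tg C Cg) MA MB !mul0r addr0 mulr0.
by move: iM; rewrite defM indexgg.
Qed.

End Quotient.

(** * The order of b when 2e = 0 *)

Section Involution.
Variables (n : nat) (e : (2 ^ n).-1%N.-tuple 'Z_(2 ^ n)).
Hypothesis n_ge2 : (2 <= n)%N.
Local Notation Z := 'Z_(2 ^ n).
Local Notation a := (aut_a n).
Local Notation b := (aut_b e).

Lemma aut_aX_cons m x w : (a ^+ m)%g (x :: w) = iter m (@ordS _) x :: w.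
Proof. by elim: m => // m IH; rewrite expgSr actM IH. Qed.

Lemma aut_aX_eq1 m : (2 ^ n %| m)%N -> (a ^+ m)%g = 1%g.
Proof.
rewrite -natr_Z_eq0 // => /eqP m0; apply: autP => -[|x w].
  by apply: size0nil; rewrite size_act.
rewrite aut_aX_cons; congr (_ :: _); apply: letter_inj => //.
rewrite -[RHS]addr0 -m0; elim: m {m0} => [|m IH]; first by rewrite addr0.
by rewrite iterS /= Zp_nat_mod ?modulus_gt1 // mulrSr IH mulrSr addrA.
Qed.

(** The sections of b^2 are the powers of a with exponents 2 e_l, all trivial, and b^2 itself at the
    last letter; induction on the word concludes. *)
Lemma aut_b_involution : (forall z, 2 * label_b e z = 0) -> (b * b)%g = 1%g.
Proof.
move=> e2; apply: autP; elim=> //= x w IH.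
congr (_ :: _); case: ifP => xn; rewrite xn; last exact: IH.
rewrite -actM -expgD aut_aX_eq1 // addnn -mul2n -natr_Z_eq0 //.
rewrite natrM natr_Zp -(e2 x%:R) /label_b val_Zp_nat ?modulus_gt1 //.
by rewrite modn_small ?ltn_ord // xn.
Qed.

Lemma label_b_neq0 : (exists l, tnth e l <> 0) -> exists z, label_b e z != 0.
Proof.
(* The tuple is indexed from 0: its component l is e_(l+1), the label at the letter of value l. *)
move=> [l /eqP el]; exists l%:R; rewrite /label_b val_Zp_nat ?modulus_gt1 //.
have ln : (l.+1 < 2 ^ n)%N by have := ltn_ord l; lia.
by rewrite modn_small ?(ltnW ln) // ln /entry /= -tnth_nth.
Qed.

End Involution.

(** * Excluding two generators for each type of subgroup of index 2 *)

Section Generators.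
Variables (n : nat) (e : (2 ^ n).-1%N.-tuple 'Z_(2 ^ n)) (k : nat).
Hypothesis n_ge2 : (2 <= n)%N.
Hypothesis k_ge3 : (3 <= k)%N.
Hypothesis e_neq0 : exists z, label_b e z != 0.
Local Notation Z := 'Z_(2 ^ n).
Local Notation a := (aut_a n).
Local Notation b := (aut_b e).
Local Notation H := (congr_quot (GGS e) k).
Local Notation h := (half_mod n).
Local Notation q := (quarter_mod n).
Implicit Types (C D : H) (i d t : Z).

(** A function [phi] of the exponents that respects their ambiguity, is additive on M and is killed
    by 2 induces a homomorphism of M to an elementary abelian group. It takes at most four values,
    so exhibiting five distinct ones refutes generation by two elements. *)
Lemma gen2_bound (A : zmodType) (phi : Z -> Z -> Z -> A) (u v : Z)
    (M : {group H}) (x y : H) :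
  M :=: <<[set x; y]>>%g ->
  (forall C i d t, coset_exponents C i d t ->
     (C \in M) = (h * (u * i + v * t) == 0)) ->
  (forall i d t c s, h * d = h * c -> h * t = h * s ->
     ((exists z, 2 * label_b e z != 0) -> q * t = q * s) ->
     phi i d t = phi i c s) ->
  (forall i d t j c s, h * (u * i + v * t) = 0 -> h * (u * j + v * s) = 0 ->
     phi (i + j) (d + c - i * s) (t + s) = phi i d t + phi j c s) ->
  (forall i d t, h * (u * i + v * t) = 0 -> phi i d t *+ 2 = 0) ->
  forall r : seq A, uniq r ->
    {in r, forall z, exists g i d t,
       [/\ exponents e g i d t, h * (u * i + v * t) = 0 & z = phi i d t]} ->
  (size r <= 4)%N.
Proof.
move=> defM memM wd add two r Ur rP.
(* Exponents are chosen for each coset; [coset_exponents_uniq] and [wd] make the value independent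
   of the choice. *)
have [f fP] : exists f : H -> A,
    forall C i d t, coset_exponents C i d t -> f C = phi i d t.
  have [f fP] := boolp.choice (@coset_exponents_ex n e k).
  have [f' f'P] := boolp.choice fP; have [f'' f''P] := boolp.choice f'P.
  exists (fun C => phi (f C) (f' C) (f'' C)) => C i d t E.
  have [<- ? ? ?] := coset_exponents_uniq n_ge2 k_ge3 e_neq0 (f''P C) E.
  exact: wd.
have fM : {in M &, forall C D, f (C * D)%g = f C + f D}.
  move=> C D MC MD.
  have [i [d [t EC]]] := coset_exponents_ex C.
  have [j [c [s ED]]] := coset_exponents_ex D.
  rewrite (fP _ _ _ _ (coset_exponentsM EC ED)) (fP _ _ _ _ EC) (fP _ _ _ _ ED).
  by apply: add; apply/eqP; rewrite -?(memM _ _ _ _ EC) -?(memM _ _ _ _ ED).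
have f2 : {in M, forall C, f C *+ 2 = 0}.
  move=> C MC; have [i [d [t EC]]] := coset_exponents_ex C.
  by rewrite (fP _ _ _ _ EC); apply/two/eqP; rewrite -(memM _ _ _ _ EC).
apply: (@uniq_leq_size _ r [:: 0; f x; f y; f x + f y]) => // z /rP.
move=> [g [i [d [t [E /eqP hM ->]]]]].
have [C _ EC] := exponents_coset k E.
rewrite -(fP _ _ _ _ EC); apply: (elementary_gen2 defM fM f2).
by rewrite (memM _ _ _ _ EC).
Qed.

Lemma exponents_eq g i d t j c s : exponents e g i d t ->
  i = j -> d = c -> t = s -> exponents e g j c s.
Proof. by move=> ? <- <- <-. Qed.

Lemma half_mod2 : h * 2 = 0.
Proof. by rewrite mulrC double_half. Qed.

Let E1 : exponents e 1%g 0 0 0.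
Proof.
rewrite -(mulgV a).
by apply: exponents_eq (exponentsM (exponents_a e) (exponentsV (exponents_a e))) _ _ _; ring.
Qed.

Let Eaa : exponents e (a * a)%g 2 0 0.
Proof.
by apply: exponents_eq (exponentsM (exponents_a e) (exponents_a e)) _ _ _; ring.
Qed.

Let Ebb : exponents e (b * b)%g 0 (-2) 2.
Proof.
by apply: exponents_eq (exponentsM (exponents_b e) (exponents_b e)) _ _ _; ring.
Qed.

Let Eab : exponents e (a * b)%g 1 (-2) 1.
Proof.
by apply: exponents_eq (exponentsM (exponents_a e) (exponents_b e)) _ _ _; ring.
Qed.

Let Ebc : exponents e (a * b * a^-1)%g 0 (-2) 1.
Proof.
by apply: exponents_eq (exponentsM Eab (exponentsV (exponents_a e))) _ _ _; ring.
Qed.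

Lemma half_modN1 : h * -1 = h.
Proof. by apply/subr0_eq; rewrite -oppr0 -half_mod2; ring. Qed.

Lemma b_in_not_gen2 (M : {group H}) (x y : H) :
  M :=: <<[set x; y]>>%g ->
  (forall C i d t, coset_exponents C i d t -> (C \in M) = (h * i == 0)) -> False.
Proof.
move=> defM memM.
(* On M the exponent i is even: q i encodes i/2 modulo 2, and the cross term i s disappears modulo
   2. *)
pose phi i d t : Z * Z * Z := (q * i, h * d, h * t).
have h0 := negPf (half_neq0 n_ge2).
(* Values at 1, a^2, b, a b a^-1 and a^2 b. *)
pose r : seq (Z * Z * Z) := [:: (0, 0, 0); (h, 0, 0); (0, h, h); (0, 0, h); (h, h, h)].
have : (size r <= 4)%N.
  apply: (@gen2_bound _ phi 1 0 M x y) => //.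
  - by move=> C i d t E; rewrite mul1r mul0r addr0; apply: memM E.
  - by move=> i d t c s; rewrite /phi => -> -> _.
  - move=> i d t j c s hi hj; congr (_, _, _); rewrite /=.
    + ring.
    + transitivity (h * d + h * c - h * (1 * i + 0 * t) * s); first ring.
      by rewrite hi mul0r subr0.
    + ring.
  - move=> i d t hi; rewrite /phi !mulr2n; congr (_, _, _); rewrite /=.
    + by rewrite -hi /half_mod; ring.
    + by rewrite -(mul0r d) -half_mod2; ring.
    + by rewrite -(mul0r t) -half_mod2; ring.
  - by rewrite /= !inE !xpair_eqE !(eq_sym 0) h0 !andbF.
  move=> z; rewrite /r !inE.
  have hq : q * 2 = h by rewrite mulrC.
  have hN2 : h * -2 = 0 by rewrite mulrN half_mod2 oppr0.
  have hN3 : h * (-1 - 2) = h by rewrite mulrBr half_modN1 half_mod2 subr0.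
  case/or4P=> [/eqP->|/eqP->|/eqP->|/orP[]/eqP->].
  - by do 4!eexists; split; [exact: E1| |rewrite /phi !mulr0];
    rewrite ?mul1r ?mul0r ?addr0 ?mulr0.
  - by do 4!eexists; split; [exact: Eaa| |rewrite /phi hq !mulr0];
    rewrite ?mul1r ?mul0r ?addr0 ?half_mod2.
  - by do 4!eexists; split; [exact: exponents_b| |rewrite /phi half_modN1 mulr1 !mulr0];
    rewrite ?mul1r ?mul0r ?addr0 ?mulr0.
  - by do 4!eexists; split; [exact: Ebc| |rewrite /phi hN2 mulr1 !mulr0];
    rewrite ?mul1r ?mul0r ?addr0 ?mulr0.
  do 4!eexists; split; [exact: exponentsM Eaa (exponents_b e)| |].
    by rewrite mul1r mul0r !addr0 half_mod2.
  rewrite /phi; congr (_, _, _); first by rewrite addr0 hq.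
    by rewrite -[LHS]hN3; congr (_ * _); ring.
  by rewrite add0r mulr1.
by [].
Qed.

Hypothesis e2_neq0 : exists z, 2 * label_b e z != 0.

Lemma a_in_not_gen2 (M : {group H}) (x y : H) :
  M :=: <<[set x; y]>>%g ->
  (forall C i d t, coset_exponents C i d t -> (C \in M) = (h * t == 0)) -> False.
Proof.
move=> defM memM.
(* On M the exponent t is even, so q t encodes t/2 modulo 2; it is well defined because 2e is
   non-zero. *)
pose phi i d t : Z * Z * Z := (h * i, h * d, q * t).
have h0 := negPf (half_neq0 n_ge2).
(* Values at 1, a, b^2, b (a b a^-1) and a b^2. *)
pose r : seq (Z * Z * Z) := [:: (0, 0, 0); (h, 0, 0); (0, 0, h); (0, h, h); (h, 0, h)].
have : (size r <= 4)%N.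
  apply: (@gen2_bound _ phi 0 1 M x y) => //.
  - by move=> C i d t E; rewrite mul1r mul0r add0r; apply: memM E.
  - by move=> i d t c s; rewrite /phi => -> _ ->.
  - move=> i d t j c s ht hs; congr (_, _, _); rewrite /=.
    + ring.
    + transitivity (h * d + h * c - h * (0 * j + 1 * s) * i); first ring.
      by rewrite hs mul0r subr0.
    + ring.
  - move=> i d t ht; rewrite /phi !mulr2n; congr (_, _, _); rewrite /=.
    + by rewrite -(mul0r i) -half_mod2; ring.
    + by rewrite -(mul0r d) -half_mod2; ring.
    + by rewrite -ht /half_mod; ring.
  - by rewrite /= !inE !xpair_eqE !(eq_sym 0) h0 !andbF.
  move=> z; rewrite /r !inE.
  have hq : q * 2 = h by rewrite mulrC.
  have hN2 : h * -2 = 0 by rewrite mulrN half_mod2 oppr0.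
  have hN3 : h * (-1 - 2) = h by rewrite mulrBr half_modN1 half_mod2 subr0.
  have hN4 : h * -4 = 0.
    transitivity (h * 2 * -2); [ring|by rewrite half_mod2 mul0r].
  case/or4P=> [/eqP->|/eqP->|/eqP->|/orP[]/eqP->].
  - by do 4!eexists; split; [exact: E1| |rewrite /phi !mulr0];
    rewrite ?mul1r ?mul0r ?addr0 ?mulr0.
  - by do 4!eexists; split; [exact: exponents_a| |rewrite /phi mulr1 !mulr0];
    rewrite ?mul1r ?mul0r ?addr0 ?mulr0.
  - by do 4!eexists; split; [exact: Ebb| |rewrite /phi hN2 hq !mulr0];
    rewrite ?mul1r ?mul0r ?add0r ?half_mod2.
  - do 4!eexists; split; [exact: exponentsM (exponents_b e) Ebc| |].
      by rewrite mul1r mul0r !add0r half_mod2.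
    rewrite /phi; congr (_, _, _); first by rewrite addr0 mulr0.
      by rewrite -[LHS]hN3; congr (_ * _); ring.
    by rewrite -[LHS]hq; congr (_ * _); ring.
  do 4!eexists; split; [exact: exponentsM (exponents_a e) Ebb| |].
    by rewrite mul1r mul0r !add0r half_mod2.
  rewrite /phi; congr (_, _, _); first by rewrite addr0 mulr1.
    by rewrite -[LHS]hN4; ring.
  by rewrite -[LHS]hq; congr (_ * _); ring.
by [].
Qed.

Lemma ab_in_not_gen2 (M : {group H}) (x y : H) :
  M :=: <<[set x; y]>>%g ->
  (forall C i d t, coset_exponents C i d t ->
     (C \in M) = (h * (i + t) == 0)) -> False.
Proof.
move=> defM memM.
(* On M the cocycle i s is i j mod 2, the coboundary of i (i - 1) / 2. *)
pose phi i d t : Z * Z * Z := (h * i, q * (i + t), h * d + q * (i * i - i)).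
have h0 := negPf (half_neq0 n_ge2).
(* Values at 1, a^2, a b, b^2 and a b^3. *)
pose r : seq (Z * Z * Z) := [:: (0, 0, 0); (0, h, h); (h, h, 0); (0, h, 0); (h, 0, 0)].
have : (size r <= 4)%N.
  apply: (@gen2_bound _ phi 1 1 M x y) => //.
  - by move=> C i d t E; rewrite !mul1r; apply: memM E.
  - move=> i d t c s; rewrite /phi => -> _ qts; congr (_, _, _).
    by rewrite !mulrDr qts.
  - move=> i d t j c s ht hs; congr (_, _, _); rewrite /=.
    + ring.
    + ring.
    + have hs' : h * j = - (h * s) by apply/subr0_eq; rewrite -[RHS]hs; ring.
      have -> : q * ((i + j) * (i + j) - (i + j)) =
        q * (i * i - i) + q * (j * j - j) + i * (h * j) by rewrite /half_mod; ring.
      transitivity (h * d + q * (i * i - i) + (h * c + q * (j * j - j)) - h * 2 * (i * s)).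
        by rewrite hs'; ring.
      by rewrite half_mod2 mul0r subr0.
  - move=> i d t ht; rewrite /phi !mulr2n; congr (_, _, _); rewrite /=.
    + by rewrite -(mul0r i) -half_mod2; ring.
    + by rewrite -ht /half_mod; ring.
    + transitivity (h * 2 * d + h * (i * i - i)); first by rewrite /half_mod; ring.
      by rewrite half_mod2 mul0r half_mulB1 // addr0.
  - by rewrite /= !inE !xpair_eqE !(eq_sym 0) h0 !andbF.
  move=> z; rewrite /r !inE.
  have hN2 : h * -2 = 0 by rewrite mulrN half_mod2 oppr0.
  have hN6 : h * -6 = 0.
    transitivity (h * 2 * -3); [ring|by rewrite half_mod2 mul0r].
  have h4 : h * 4 = 0.
    transitivity (h * 2 * 2); [ring|by rewrite half_mod2 mul0r].
  have hq : q * 2 = h by rewrite mulrC.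
  case/or4P=> [/eqP->|/eqP->|/eqP->|/orP[]/eqP->].
  - do 4!eexists; split; [exact: E1| |rewrite /phi; congr (_, _, _)]; ring.
  - do 4!eexists; split; [exact: Eaa| |rewrite /phi; congr (_, _, _)].
    + by rewrite -[RHS]half_mod2; ring.
    + by rewrite -[LHS]half_mod2; ring.
    + by rewrite -[LHS]hq; ring.
    + by rewrite -[LHS]hq; ring.
  - do 4!eexists; split; [exact: Eab| |rewrite /phi; congr (_, _, _)].
    + by rewrite -[RHS]half_mod2; ring.
    + by ring.
    + by rewrite -[LHS]hq; ring.
    + by rewrite -[LHS]hN2; ring.
  - do 4!eexists; split; [exact: Ebb| |rewrite /phi; congr (_, _, _)].
    + by rewrite -[RHS]half_mod2; ring.
    + by ring.
    + by rewrite -[LHS]hq; ring.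
    + by rewrite -[LHS]hN2; ring.
  do 4!eexists; split; [exact: exponentsM Eab Ebb| |rewrite /phi; congr (_, _, _)].
  + by rewrite -[RHS]h4; ring.
  + by ring.
  + by rewrite -[LHS]half_mod2 /half_mod; ring.
  by rewrite -[LHS]hN6; ring.
by [].
Qed.

End Generators.

Theorem mainTheorem3 (n : nat) (e : (2 ^ n).-1.-tuple 'Z_(2 ^ n)) (mG : nat) :
  (2 <= n)%N ->
  (exists l, tnth e l <> 0%R) ->
  infinite_set (GGS e) ->
  periodic (GGS e) ->
  is_m_G e mG ->
  forall k : nat, (mG <= k)%N ->
    ~ admits_mixed_Beauville [set: congr_quot (GGS e) k]%G.
Proof.
move=> n_ge2 /(label_b_neq0 n_ge2) e_neq0 _ _.
move=> [q [d [l [m00 [m10 [_ _ _ _ ->]]]]]] k mk [M [x [y]]] [[_ iM] defM _ sq].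
(* The summand 3 of m_G places k at level 3 or below it in the tree. *)
have k_ge3 : (3 <= k)%N by apply: leq_trans mk; rewrite addn3.
have [r [s [rs memM]]] := index2_linear n_ge2 iM.
(* [s] says that b lies outside M. If 2e = 0, the class of b then squares to 1, an element of
   [Sigma], against the last condition of the structure. *)
have bM : s -> (exists z, 2 * label_b e z != 0).
  move=> s1; apply: contrapT => e2.
  have bb : (aut_b e * aut_b e)%g = 1%g.
    apply: aut_b_involution => // z; apply/eqP/negPn/negP => z2.
    by apply: e2; exists z.
  have [B Bb EB] := exponents_coset k (exponents_b e).
  have B2 : (B ^+ 2)%g = 1%g.
    apply: quotP; rewrite expgS expg1 /= Bb St_cosetM ?bb //;
      exact: exponents_GGS (exponents_b e).
  have : B \in [set: congr_quot (GGS e) k] :\: M.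
    rewrite !inE andbT (memM _ _ _ _ EB) s1 mulr0 add0r !mulr1.
    exact: half_neq0.
  move/sq; rewrite B2 => /negP[]; apply/bigcupP; exists 1%g => //.
  by rewrite !inE conjsg1 group1.
(* The three non-trivial characters: M contains neither a nor b, or b only, or a only. *)
case: r s rs memM bM => -[] // _ memM bM.
- apply: (ab_in_not_gen2 n_ge2 k_ge3 e_neq0 (bM isT) defM) => C i c t.
  by move/memM->; rewrite !mul1r.
- apply: (b_in_not_gen2 n_ge2 k_ge3 e_neq0 defM) => C i c t.
  by move/memM->; rewrite mul1r mul0r addr0.
apply: (a_in_not_gen2 n_ge2 k_ge3 e_neq0 (bM isT) defM) => C i c t.
by move/memM->; rewrite mul1r mul0r add0r.
Qed.
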